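(* There exist a compact metric space $(X,d)$ and a finite family $\mathcal{F}=\{f_1,\dots,f_k\}$ of continuous maps $f_i:X\to X$ such that $\mathrm{IFS}(X;\mathcal{F})$ is weak topologically exact, is not minimal, is sensitive, and is not an $M$-system.
   Context: $\mathcal{F}^+$ is the semigroup of all compositions of finitely many (at least one) elements of $\mathcal{F}$, and $\mathrm{IFS}(X;\mathcal{F})$ is the associated iterated function system. The forward orbit of $x$ is $\mathcal{O}^+_{\mathcal{F}}(x)=\{h(x):h\in\mathcal{F}^+\}$. The IFS is weak topologically exact if for every nonempty open set $U\subseteq X$ there are finitely many $T_1,\dots,T_N\in\mathcal{F}^+$ such that $\bigcup_{i=1}^N T_i(U)$ is dense in $X$. It is minimal if $\overline{\mathcal{O}^+_{\mathcal{F}}(x)}=X$ for every $x\in X$. It is transitive if for any nonempty open $U,V\subseteq X$ there is $h\in\mathcal{F}^+$ with $h(U)\cap V\neq\emptyset$. For $\omega=(\omega_1\omega_2\dots)\in\{1,\dots,k\}^{\mathbb{N}}$ put $f_\omega^0=\mathrm{Id}$ and $f_\omega^n=f_{\omega_n}\circ f_\omega^{n-1}$ for $n\ge1$, and $d_{\mathcal{F}}(x_1,x_2)=\sup_{\omega,\,n\ge0}d(f_\omega^n(x_1),f_\omega^n(x_2))$. The IFS is sensitive if there is $\varepsilon>0$ such that every nonempty open subset of $X$ has $d_{\mathcal{F}}$-diameter at least $\varepsilon$. A point $x$ is almost periodic if the subsystem $K=\overline{\mathcal{O}^+_{\mathcal{F}}(x)}$ is compact and minimal (i.e. $\overline{\mathcal{O}^+_{\mathcal{F}}(z)}=K$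 for every $z\in K$). The IFS is an $M$-system if it is transitive and its set of almost periodic points is dense in $X$. *)

(* Defs.v *)
From mathcomp Require Import all_boot all_order all_algebra.
From mathcomp Require Import all_classical all_reals topology ereal.

Set Implicit Arguments.
Unset Strict Implicit.
Unset Printing Implicit Defensive.

Local Open Scope classical_set_scope.
Local Open Scope ring_scope.

(* The semigroup F^+ generated by f_1, ..., f_k under composition; the identity
   belongs to it only if it is a composition of at least one f_i. *)
Inductive ifs_semigroup (X : Type) (k : nat) (f : 'I_k -> X -> X) :
    (X -> X) -> Prop :=
| ifs_semigroup_gen (i : 'I_k) : ifs_semigroup f (f i)
| ifs_semigroup_comp (g h : X -> X) :
    ifs_semigroup f g -> ifs_semigroup f h -> ifs_semigroup f (g \o h).

Definition forward_orbit (X : Type) (k : nat) (f : 'I_k -> X -> X) (x : X) :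
    set X :=
  [set h x | h in ifs_semigroup f].

Definition weak_topologically_exact (X : topologicalType) (k : nat)
    (f : 'I_k -> X -> X) : Prop :=
  forall U : set X, open U -> U !=set0 ->
    exists (N : nat) (T : 'I_N -> X -> X),
      (forall i, ifs_semigroup f (T i)) /\ dense (\bigcup_i (T i @` U)).

Definition ifs_minimal (X : topologicalType) (k : nat)
    (f : 'I_k -> X -> X) : Prop :=
  forall x : X, closure (forward_orbit f x) = [set: X].

Definition ifs_transitive (X : topologicalType) (k : nat)
    (f : 'I_k -> X -> X) : Prop :=
  forall U V : set X, open U -> U !=set0 -> open V -> V !=set0 ->
    exists2 h : X -> X, ifs_semigroup f h & (h @` U) `&` V !=set0.

(* Words are indexed from 0: [w n] is the letter written omega_(n+1) in the
   usual notation omega = (omega_1 omega_2 ...). *)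
Fixpoint ifs_iter (X : Type) (k : nat) (f : 'I_k -> X -> X) (w : nat -> 'I_k)
    (n : nat) : X -> X :=
  if n is m.+1 then f (w m) \o ifs_iter f w m else id.

(* Suprema are taken in the extended reals, so that they are genuine least
   upper bounds without any boundedness proof. *)
Definition ifs_dist (R : realType) (X : metricType R) (k : nat)
    (f : 'I_k -> X -> X) (x1 x2 : X) : \bar R :=
  ereal_sup [set (mdist (ifs_iter f w n x1) (ifs_iter f w n x2))%:E
            | w in [set: nat -> 'I_k] & n in [set: nat]].

Definition ifs_diameter (R : realType) (X : metricType R) (k : nat)
    (f : 'I_k -> X -> X) (U : set X) : \bar R :=
  ereal_sup [set ifs_dist f x1 x2 | x1 in U & x2 in U].

Definition ifs_sensitive (R : realType) (X : metricType R) (k : nat)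
    (f : 'I_k -> X -> X) : Prop :=
  exists2 eps : R, 0 < eps &
    forall U : set X, open U -> U !=set0 -> (eps%:E <= ifs_diameter f U)%E.

Definition almost_periodic (X : topologicalType) (k : nat)
    (f : 'I_k -> X -> X) (x : X) : Prop :=
  let K := closure (forward_orbit f x) in
  compact K /\ (forall z, K z -> closure (forward_orbit f z) = K).

Definition M_system (X : topologicalType) (k : nat)
    (f : 'I_k -> X -> X) : Prop :=
  ifs_transitive f /\ dense [set x | almost_periodic f x].

(* Main.v *)
(** On [0, 1] take the tent map and the constant map 0.  An inverse branch of the
    tent map halves distances, so every point lies within 2^-n of some n-th
    preimage of any given point, and an iterate of the tent map sends a given
    nonempty open set onto [0, 1]; this gives both exactness and sensitivity.
    Since 0 is fixed by both maps and belongs to every forward orbit, the orbit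
    of an almost periodic point is {0}; so the open set where the tent map does
    not vanish contains no almost periodic point. *)
Require Import Defs.
From HB Require Import structures.
From mathcomp Require Import all_boot all_order all_algebra.
From mathcomp Require Import all_classical all_reals topology ereal.
From mathcomp Require Import normedtype sequences.
From mathcomp Require Import lra.

Import Order.TTheory GRing.Theory Num.Theory.
Import numFieldNormedType.Exports.

Local Open Scope classical_set_scope.

Section set_type_metric.
Local Open Scope ring_scope.
Context {R : realType} {X : metricType R} (A : set X).

Let dist (x y : A) : R := mdist (\val x) (\val y).

Let dist_ge0 x y : 0 <= dist x y. Proof. exact: mdist_ge0. Qed.

Let dist_positivity x y : dist x y = 0 -> x = y.
Proof. by move=> /mdist_positivity /val_inj. Qed.

Let ballEdist (x : A) d : ball x d = [set y | dist x y < d].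
Proof. by rewrite -initial_ballE ballEmdist. Qed.

(** The pseudometric that the subtype inherits along [\val] is kept and only upgraded to a metric,
    so its topology remains the initial one. *)
HB.instance Definition _ := PseudoMetric_isMetric.Build R (set_type A)
  dist_ge0 dist_positivity ballEdist.

End set_type_metric.


Section common_fixed_point.
Context {X : topologicalType} {k : nat}.
Implicit Types (f : 'I_k -> X -> X) (p x : X).

Lemma semigroup_fix f p h :
  (forall i, f i p = p) -> ifs_semigroup f h -> h p = p.
Proof. by move=> fp; elim=> [i|g {}h _ gp _ hp] //=; rewrite hp. Qed.

(** A common fixed point is fixed by the whole semigroup, and singletons are closed in a T1
    space. *)
Lemma closure_orbit_fix f p : accessible_space X ->
  (forall i, f i p = p) -> closure (forward_orbit f p) `<=` [set p].
Proof.
move=> T1 fp.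
rewrite [X in _ `<=` X](iffLR (closure_id _)); last first.
  exact: accessible_closed_set1.
by apply: closureS => _ [h /(semigroup_fix _ _ _ fp) hp <-].
Qed.

Lemma not_minimal_fix f p q : accessible_space X ->
  (forall i, f i p = p) -> q <> p -> ~ ifs_minimal f.
Proof.
move=> T1 fp qp /(_ p) fmin.
by apply/qp/(closure_orbit_fix _ _ T1 fp); rewrite fmin.
Qed.

(* The orbit closure of [x] need not contain [x], so [x = p] may fail. *)
Lemma almost_periodic_fix f p x : accessible_space X ->
  (forall i, f i p = p) -> forward_orbit f x p ->
  almost_periodic f x -> forall i, f i x = p.
Proof.
move=> T1 fp xp [_ Kmin] i; apply: (closure_orbit_fix _ _ T1 fp).
(* Minimality at [p], a point of the orbit closure of [x], identifies that closure with the orbit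
   closure of [p]. *)
rewrite Kmin; last exact: subset_closure.
by apply: subset_closure; exists (f i) => //; exact: ifs_semigroup_gen.
Qed.

Lemma not_M_system_fix f p i q : accessible_space X ->
  (forall i, f i p = p) -> (forall x, forward_orbit f x p) ->
  continuous (f i) -> f i q <> p -> ~ M_system f.
Proof.
move=> T1 fp orbp fc fq [_ /(_ (f i @^-1` (~` [set p])))].
case=> [|| x []]; first by exists q.
- apply: open_comp => [x _|]; first exact: fc.
  by rewrite openC; exact: accessible_closed_set1.
- by move=> /= fx /(almost_periodic_fix _ _ _ T1 fp (orbp x)) /(_ i).
Qed.

End common_fixed_point.

Section tent_map.
Local Open Scope ring_scope.
Context {R : realType}.

Definition unit_interval : set R^o := [set x : R^o | 0 <= x <= 1].

Definition clampR (t : R^o) : R^o := Num.max 0 (Num.min 1 t).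

Lemma clampR_subproof (t : R^o) : clampR t \in unit_interval.
Proof.
by rewrite inE /unit_interval/= /clampR le_max lexx/= ge_max ler01 ge_min lexx.
Qed.

(** A continuous retraction of the line onto the interval: self-maps of the subtype can then be
    given by real formulas, and compactness comes from that of the segment. *)
Definition clamp (t : R^o) : unit_interval :=
  exist _ (clampR t) (clampR_subproof t).

Lemma unit_intervalP (x : unit_interval) : 0 <= \val x <= 1.
Proof. by have := set_valP x. Qed.

Lemma mdist_unit_interval (x y : unit_interval) :
  mdist x y = `|\val y - \val x|.
Proof. by []. Qed.

Lemma val_clamp (t : R^o) : 0 <= t <= 1 -> \val (clamp t) = t.
Proof.
move=> /andP[t0 t1]; rewrite /= /clampR.
by rewrite (min_idPr t1) (max_idPr t0).
Qed.

Lemma clampK (x : unit_interval) : clamp (\val x) = x.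
Proof. exact/val_inj/val_clamp/unit_intervalP. Qed.

Lemma clamp_continuous : continuous clamp.
Proof.
apply: continuous_comp_initial => t /=.
apply: (@continuous_max R R^o (cst 0) (cst 1 \min id)); first exact: cvg_cst.
by apply: (@continuous_min R R^o (cst 1) id); [exact: cvg_cst|exact: cvg_id].
Qed.

Lemma val_continuous : continuous (\val : unit_interval -> R^o).
Proof. exact: initial_continuous. Qed.

Lemma unit_interval_compact : compact [set: unit_interval].
Proof.
have -> : [set: unit_interval] = clamp @` `[0, 1].
  apply/seteqP; split => // x _; exists (\val x); last exact: clampK.
  by rewrite /= in_itv; exact: unit_intervalP.
apply: continuous_compact; last exact: segment_compact.
exact/continuous_subspaceT/clamp_continuous.
Qed.

(** The formula is [2 * x] on the left half and [2 - 2 * x] on the right half. *)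
Definition tent (x : unit_interval) : unit_interval :=
  clamp (1 - `|2 * \val x - 1|).

Lemma val_tent x : \val (tent x) = 1 - `|2 * \val x - 1|.
Proof.
have /andP[x0 x1] := unit_intervalP x; apply: val_clamp.
rewrite subr_ge0 gerBl normr_ge0 andbT ler_norml; lra.
Qed.

Lemma tent_continuous : continuous tent.
Proof.
pose g (t : R^o) : R^o := 1 - `|2 * t - 1|.
have g_continuous : continuous g.
  move=> t; apply: (@cvgB R R^o); first exact: cvg_cst.
  apply: (@cvg_norm R R^o); apply: (@cvgB R R^o); last exact: cvg_cst.
  by apply: cvgM; [exact: cvg_cst|exact: cvg_id].
move=> x; apply: (@continuous_comp unit_interval R^o _ (g \o \val) clamp).
  by apply: continuous_comp; [exact: val_continuous|exact: g_continuous].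
exact: clamp_continuous.
Qed.

(** Induction on [n]: a point near [tent z] is pulled back to a point twice as near to [z]. *)
Lemma iter_tent_onto n (y z : unit_interval) :
  exists2 x : unit_interval, mdist z x <= 2^-1 ^+ n & iter n tent x = y.
Proof.
elim: n z => [|n IHn] z.
  exists y => //; rewrite mdist_unit_interval expr0.
  have /andP[? ?] := unit_intervalP y; have /andP[? ?] := unit_intervalP z.
  rewrite ler_norml; lra.
have [x' ] := IHn (tent z).
rewrite mdist_unit_interval val_tent => zx' x'y.
have /andP[? ?] := unit_intervalP x'; have /andP[? ?] := unit_intervalP z.
(* The preimage of [x'] in the same half as [z], where [tent] is affine of slope 2 or -2. *)
pose t : R^o := if \val z <= 2^-1 then \val x' / 2 else 1 - \val x' / 2.
have tv : \val (clamp t) = t by apply: val_clamp; rewrite /t; case: ifP; lra.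
exists (clamp t).
  rewrite mdist_unit_interval tv /t exprS.
  move: zx'; set e := _ ^+ n; rewrite !ler_norml.
  case: (lerP (\val z)) => ?.
    rewrite ler0_norm; lra.
  rewrite ger0_norm; lra.
rewrite iterSr -x'y; congr (iter n tent _); apply: val_inj.
rewrite val_tent tv /t; case: ifP => _.
  rewrite ler0_norm; lra.
rewrite ger0_norm; lra.
Qed.

(** A ball inside [U] contains a preimage of every point once its radius exceeds the power of 1/2.
    The exponent [n.+1] ensures at least one application of [tent], as membership in the semigroup
    requires. *)
Lemma iter_tent_onto_open (U : set unit_interval) : open U -> U !=set0 ->
  exists n, forall y, exists2 x, U x & iter n.+1 tent x = y.
Proof.
move=> Uo [z Uz].
have /nbhs_ballP[e /= e0 eU] : nbhs z U by exact: open_nbhs_nbhs.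
have /cvgrPdist_lt /(_ e e0)[N _ /(_ N (leqnn N))] :
    ((2^-1 : R) ^+ n @[n --> \oo]) --> (0 : R).
  by apply: cvg_expr; rewrite ger0_norm ?invr_ge0// invf_lt1 ?ltr1n.
move=> /=; rewrite sub0r normrN ger0_norm ?exprn_ge0 ?invr_ge0// => Ne.
exists N => y; have [x zx xy] := iter_tent_onto N.+1 y z.
exists x => //; apply: eU; rewrite ballEmdist /=.
apply: le_lt_trans zx (le_lt_trans _ Ne).
by rewrite exprS ler_piMl ?exprn_ge0 ?invr_ge0// invf_le1 ?ler1n.
Qed.

Definition zero : unit_interval := clamp 0.
Definition one : unit_interval := clamp 1.

Lemma val_zero : \val zero = 0.
Proof. apply: val_clamp; lra. Qed.
Lemma val_one : \val one = 1.
Proof. apply: val_clamp; lra. Qed.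

Definition tent_ifs (i : 'I_2) : unit_interval -> unit_interval :=
  if i == ord0 then cst zero else tent.

Lemma tent_ifs_continuous i : continuous (tent_ifs i).
Proof.
rewrite /tent_ifs; case: ifP => _; last exact: tent_continuous.
by move=> x; exact: cst_continuous.
Qed.

Lemma tent_ifs_fix i : tent_ifs i zero = zero.
Proof.
rewrite /tent_ifs; case: ifP => // _; apply: val_inj; rewrite val_tent val_zero.
by rewrite mulr0 sub0r normrN normr1 subrr.
Qed.

Lemma zero_in_orbit x : forward_orbit tent_ifs x zero.
Proof. by exists (tent_ifs ord0) => //; exact: ifs_semigroup_gen. Qed.

Lemma semigroup_iter_tent n : ifs_semigroup tent_ifs (iter n.+1 tent).
Proof.
elim: n => [|n IHn]; first exact: (ifs_semigroup_gen tent_ifs ord_max).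
exact: (ifs_semigroup_comp (ifs_semigroup_gen tent_ifs ord_max) IHn).
Qed.

Lemma ifs_iter_tent n x :
  ifs_iter tent_ifs (fun=> ord_max) n x = iter n tent x.
Proof. by elim: n => //= n ->. Qed.

End tent_map.

Theorem corollary4p3 (R : realType) :
  exists (X : metricType R) (k : nat) (f : 'I_k -> X -> X),
    compact [set: X] /\ (0 < k)%N /\ (forall i, continuous (f i)) /\
    weak_topologically_exact f /\
    ~ ifs_minimal f /\
    ifs_sensitive f /\
    ~ M_system f.
Proof.
have T1 : accessible_space (@unit_interval R).
  by exact/hausdorff_accessible/metric_hausdorff.
have one0 : one <> zero :> @unit_interval R.
  by move=> /(congr1 \val); rewrite val_zero val_one => /eqP; rewrite oner_eq0.
exists (@unit_interval R), 2%N, tent_ifs; do !split.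
- exact: unit_interval_compact.
- exact: tent_ifs_continuous.
- move=> U Uo U0; have [n Un] := iter_tent_onto_open U Uo U0.
  (* A single map suffices, since the image of [U] is the whole interval. *)
  exists 1%N, (fun=> iter n.+1 tent); split => [_|V [y Vy] _].
    exact: semigroup_iter_tent.
  have [x Ux xy] := Un y; exists y; split => //.
  by exists ord0 => //; exists x.
- exact: (not_minimal_fix _ _ _ T1 tent_ifs_fix one0).
(* The constant 1 is the distance from [zero] to [one]; the same iterate reaches both from [U],
   along the constant word that always selects [tent]. *)
- exists 1%R => // U Uo U0; have [n Un] := iter_tent_onto_open U Uo U0.
  have [x Ux x0] := Un zero; have [y Uy y1] := Un one.
  apply: (@le_trans _ _ (ifs_dist tent_ifs x y)); last first.
    by apply: ereal_sup_ubound; exists x => //; exists y.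
  apply: ereal_sup_ubound; exists (fun=> ord_max) => //; exists n.+1 => //.
  rewrite !ifs_iter_tent x0 y1.
  by rewrite mdist_unit_interval val_zero val_one subr0 normr1.
(* The midpoint is the peak of the tent, with image [one]. *)
- apply: (not_M_system_fix _ _ ord_max (clamp 2^-1%R) T1
    tent_ifs_fix zero_in_orbit).
    exact: tent_ifs_continuous.
  move=> /(congr1 \val); rewrite val_tent val_zero val_clamp; last by lra.
  by rewrite divff ?subrr ?normr0 ?subr0 => // /eqP; rewrite oner_eq0.
Qed.
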